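(* Let $c\geq1$, $d\geq 0$ be integers, $k$ a constant, and let $\operatorname{ext}\colon\mathbb{N}\to\mathbb{N}$ be a function with the property: for every $(c,d)$-hypergraph $H=(V,E)$, every $\gamma\colon E\to[0,1]$ with $\operatorname{weight}(\gamma)\leq k$ and every well-formed pair $(\mathbf{S},U)$ with $\mathbf{S}\ne\emptyset$ all of whose elements have size at most $c-1$, either $(\mathbf{S},U)$ is perfect or it has an extension of size at most $\operatorname{ext}(n(\mathbf{S},U))$. Then there is a monotone function $\operatorname{sl}\colon\mathbb{N}\to\mathbb{N}$ such that for every such $H,\gamma$ and every sequence of transformations $(\mathbf{S}_1,U_1),\dots,(\mathbf{S}_q,U_q)$ we have $q\leq\operatorname{sl}(n(\mathbf{S}_1,U_1))$.
   Context: A hypergraph $H=(V,E)$ has a finite vertex set $V$ and a set $E$ of non-empty subsets of $V$; it is a $(c,d)$-hypergraph if any $c$ distinct edges have at most $d$ common vertices. For $\gamma\colon E\to[0,1]$: $B(\gamma)=\{v\mid\sum_{e\ni v}\gamma(e)\geq1\}$, $\operatorname{support}(\gamma)=\{e\mid\gamma(e)\neq0\}$, $\operatorname{weight}(\gamma)=\sum_e\gamma(e)$. $\bigcap S$ / $\bigcup S$ denote the vertices in all / some edges of a set $S$ of edges. A pair $(\mathbf{S},U)$ is well-formed if (1) $U\subseteq B(\gamma)$, (2) $\mathbf{S}=\{S_1,\dots,S_r\}$ is a finite collection of sets each of at most $c$ edges, (3) $B(\gamma)\setminus U\subseteq\bigcup_{i}\bigcap S_i$; its size is $n(\mathbf{S},U)=\sum_i|S_i|+2^{|U|}$;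 it is perfect if some $\nu\colon E\to[0,1]$ has $\operatorname{weight}(\nu)\leq k$, $|\operatorname{support}(\nu)|\leq n(\mathbf{S},U)$ and $\bigcup_i\bigcap S_i\cup U\subseteq B(\nu)$. Folding: if some $S^*\in\mathbf{S}$ has $|S^*|=c$, the pair $(\mathbf{S}\setminus\{S^*\},\,U\cup(\bigcap S^*\cap B(\gamma)))$ is a folding. Extension: if $\mathbf{S}\ne\emptyset$ and all elements of $\mathbf{S}$ have size at most $c-1$, for $S\in\mathbf{S}$ and $T\subseteq E$, with $L=(\bigcap S\cap B(\gamma))\setminus\bigcup T$, the pair $((\mathbf{S}\setminus\{S\})\cup\{S\cup\{e\}\mid e\in T\},\,U\cup L)$ is an extension. A transformation of $(\mathbf{S},U)$ is a well-formed pair that is a folding of it or an extension of it of size at most $\operatorname{ext}(n(\mathbf{S},U))$. A sequence of transformations is a sequence of well-formed pairs $(\mathbf{S}_1,U_1),\dots,(\mathbf{S}_q,U_q)$ such that for each $i\in[q-1]$, $(\mathbf{S}_i,U_i)$ is not perfect and $(\mathbf{S}_{i+1},U_{i+1})$ is a transformation of $(\mathbf{S}_i,U_i)$.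
   Formalization: In the definition of extension, T is required to be a subset of E \ S instead of E: if T may meet S, a non-perfect pair can be an extension of itself (e.g. c=2, d=0, k=0, ext=id, S=T={e}), so sequences could be arbitrarily long. *)

(* Defs.v *)
From mathcomp Require Import all_boot all_order all_algebra.
From mathcomp Require Import reals.
Set Implicit Arguments.
Unset Strict Implicit.
Unset Printing Implicit Defensive.
Import Order.TTheory GRing.Theory Num.Theory.

Record hypergraph := Hypergraph {
  vertex : finType;
  edges : {set {set vertex}};
  edges_nonempty : set0 \notin edges }.

(* For S = set0 this is the full vertex set. *)
Definition inter_edges (V : finType) (S : {set {set V}}) : {set V} :=
  \bigcap_(e in S) e.

Definition union_edges (V : finType) (S : {set {set V}}) : {set V} :=
  \bigcup_(e in S) e.

Definition cd_hypergraph (c d : nat) (H : hypergraph) : Prop :=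
  forall S : {set {set vertex H}},
    S \subset edges H -> #|S| = c -> #|inter_edges S| <= d.

Section Pairs.
Variables (R : realType) (H : hypergraph).
Local Notation V := (vertex H).
Local Notation E := (edges H).

(* A function E -> [0,1] is represented by a total function on vertex sets;
   its values outside E are never used. *)
Definition edge_weighting (g : {set V} -> R) : Prop :=
  forall e, e \in E -> (0 <= g e <= 1)%R.

Definition covered (g : {set V} -> R) : {set V} :=
  [set v | (1 <= \sum_(e in E | v \in e) g e)%R].

Definition support (g : {set V} -> R) : {set {set V}} :=
  [set e in E | g e != 0%R].

Definition weight (g : {set V} -> R) : R := (\sum_(e in E) g e)%R.

Definition edge_pair : Type := ({set {set {set V}}} * {set V})%type.

Definition inter_union (SS : {set {set {set V}}}) : {set V} :=
  \bigcup_(S in SS) inter_edges S.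

Definition well_formed (c : nat) (g : {set V} -> R) (p : edge_pair) : Prop :=
  [/\ p.2 \subset covered g,
      forall S, S \in p.1 -> S \subset E /\ #|S| <= c
    & covered g :\: p.2 \subset inter_union p.1].

Definition pair_size (p : edge_pair) : nat :=
  \sum_(S in p.1) #|S| + 2 ^ #|p.2|.

Definition perfect (k : R) (p : edge_pair) : Prop :=
  exists nu : {set V} -> R,
    [/\ edge_weighting nu,
        (weight nu <= k)%R,
        #|support nu| <= pair_size p
      & inter_union p.1 :|: p.2 \subset covered nu].

Definition folding (c : nat) (g : {set V} -> R) (p p' : edge_pair) : Prop :=
  exists S : {set {set V}},
    [/\ S \in p.1, #|S| = c
      & p' = (p.1 :\ S, p.2 :|: (inter_edges S :&: covered g))].

Definition extendable (c : nat) (p : edge_pair) : Prop :=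
  p.1 != set0 /\ forall S, S \in p.1 -> #|S| <= c - 1.

(* The edges of T are taken outside S, so that every e |: S has exactly one edge
   more than S. If T could meet S, then T = [set e] with e \in S would make p an
   extension of itself, and sequences of transformations could be arbitrarily
   long. *)
Definition extension (c : nat) (g : {set V} -> R) (p p' : edge_pair) : Prop :=
  extendable c p /\
  exists S T : {set {set V}},
    [/\ S \in p.1, T \subset E :\: S
      & p' = ((p.1 :\ S) :|: [set e |: S | e in T],
              p.2 :|: ((inter_edges S :&: covered g) :\: union_edges T))].

Definition transformation (c : nat) (ext : nat -> nat) (g : {set V} -> R)
    (p p' : edge_pair) : Prop :=
  well_formed c g p' /\
  (folding c g p p' \/
   (extension c g p p' /\ pair_size p' <= ext (pair_size p))).

Definition transformation_sequence (c : nat) (k : R) (ext : nat -> nat)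
    (g : {set V} -> R) (s : seq edge_pair) : Prop :=
  (forall p, p \in s -> well_formed c g p) /\
  (forall i, i.+1 < size s ->
     ~ perfect k (nth (set0, set0) s i) /\
     transformation c ext g (nth (set0, set0) s i) (nth (set0, set0) s i.+1)).

End Pairs.

Definition extension_bound (R : realType) (c d : nat) (k : R)
    (ext : nat -> nat) : Prop :=
  forall (H : hypergraph) (g : {set vertex H} -> R) (p : edge_pair H),
    cd_hypergraph c d H -> edge_weighting g -> (weight g <= k)%R ->
    well_formed c g p -> extendable c p ->
    perfect k p \/
    exists p', extension c g p p' /\ pair_size p' <= ext (pair_size p).

(* Main.v *)
Require Import Defs.
From mathcomp Require Import all_boot all_order all_algebra.
From mathcomp Require Import boolp reals.

(** Record a pair [(SS, U)] by its profile, the numbers of elements of [SS] of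
    size [0], ..., [c]. A transformation removes one element [S] of [SS] and
    adds only elements larger than [S], so it makes the profile
    lexicographically smaller. Moreover the size after a transformation is
    bounded in terms of the size before it (for a folding, because [c] distinct
    edges have at most [d] common vertices), and every entry of the profile is
    at most the size. Hence only finitely many profiles can follow a given one
    at a given size, and well-founded induction on the lexicographic order
    bounds the length of every sequence of transformations. *)

Set Implicit Arguments.
Unset Strict Implicit.
Unset Printing Implicit Defensive.

Fixpoint lex_lt (w v : seq nat) : bool :=
  match w, v with
  | a :: w', b :: v' => (a < b) || (a == b) && lex_lt w' v'
  | _, _ => false
  end.

(** Comparing only sequences of equal length makes the order well-founded: the induction is on the
    length, then on the head, then on the tail. *)
Lemma lex_lt_ind (P : seq nat -> Prop) :
  (forall v, (forall w, size w = size v -> lex_lt w v -> P w) -> P v) ->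
  forall v, P v.
Proof.
move=> IH v; move: {2}(size v) (erefl (size v)) => r.
elim: r P IH v => [|r IHr] P IH [|a v] //=.
  by move=> _; apply: IH => -[].
move=> [sz_v]; elim/ltn_ind: a v sz_v => a IHa v sz_v.
apply: (IHr (fun v => size v = r -> P (a :: v)) _ v sz_v sz_v).
move=> {sz_v}v IHv sz_v.
apply: IH => -[|b w] //= [sz_w] /orP[lt_ba|/andP[/eqP-> lt_wv]].
  by apply: IHa => //; rewrite sz_w.
by apply: IHv => //; rewrite sz_w.
Qed.

Lemma lex_lt_mkseq (r i : nat) (f g : nat -> nat) :
  i < r -> f i < g i -> (forall j, j < i -> f j = g j) ->
  lex_lt (mkseq f r) (mkseq g r).
Proof.
elim: r i f g => [|r IHr] i f g //= lt_ir lt_fg eq_fg.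
(* Shifting [iota 1 r] back to [iota 0 r] makes the tails [mkseq] of [f \o succn] and
   [g \o succn]. *)
rewrite /mkseq /= -[1]addn0 !iotaDl -!map_comp.
case: i lt_ir lt_fg eq_fg => [|i] lt_ir lt_fg eq_fg; first by rewrite lt_fg.
rewrite (eq_fg 0) // eqxx /= orbC.
by rewrite (IHr i (f \o succn) (g \o succn)) //= => j lt_ji; apply: eq_fg.
Qed.

(** A finite type indexes the profiles with entries at most [N], so that a maximum over them can be
    taken. *)
Definition seq_of_ffun (c N : nat) (t : {ffun 'I_c.+1 -> 'I_N.+1}) : seq nat :=
  mkseq (fun i => t (inord i) : nat) c.+1.

Section Profile.
Variable H : hypergraph.
Implicit Types (p q : edge_pair H) (S : {set {set vertex H}}).

Definition size_count p (i : nat) : nat := #|[set S in p.1 | #|S| == i]|.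

Definition profile (c : nat) p : seq nat := mkseq (size_count p) c.+1.

(* The summand [2 ^ #|U|] of the size accounts for the empty set of edges. *)
Lemma card_le_pair_size p : #|p.1| <= pair_size p.
Proof.
rewrite /pair_size (cardsD1 set0) addnC leq_add //; last first.
  by apply: leq_trans (leq_b1 _) _; rewrite expn_gt0.
rewrite -sum1_card (big_setID [set set0] (A := p.1)) /=.
apply: leq_trans (leq_addl _ _); apply: leq_sum => S.
by rewrite !inE card_gt0 => /andP[].
Qed.

Lemma size_count_le p i : size_count p i <= pair_size p.
Proof.
apply: leq_trans (card_le_pair_size p); apply: subset_leq_card.
by apply/subsetP=> S; rewrite inE => /andP[].
Qed.

Lemma profile_bounded (c N : nat) p :
  pair_size p <= N ->
  exists t : {ffun 'I_c.+1 -> 'I_N.+1}, profile c p = seq_of_ffun t.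
Proof.
move=> le_pN; exists [ffun i : 'I_c.+1 => inord (size_count p i)].
apply/eq_in_map => i; rewrite mem_iota add0n => /andP[_ lt_ic].
by rewrite ffunE !inordK // ltnS (leq_trans (size_count_le p i)).
Qed.

(** The first entry to change is the one at [#|S|]: the sets in [N] count only at larger sizes, and
    losing [S] lowers this entry by one. *)
Lemma profile_replace (c : nat) p q S (N : {set {set {set vertex H}}}) :
  S \in p.1 -> #|S| <= c -> q.1 = (p.1 :\ S) :|: N ->
  (forall S', S' \in N -> #|S| < #|S'|) ->
  lex_lt (profile c q) (profile c p).
Proof.
move=> Sp Sc q1 NS.
have countE i : i <= #|S| ->
    size_count q i = #|[set S' in p.1 :\ S | #|S'| == i]|.
  move=> le_iS; apply: eq_card => S'; rewrite q1 !inE.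
  case: (boolP (S' \in N)) => [/NS lt_SS'|_]; last by rewrite orbF.
  by rewrite gtn_eqF ?andbF //; apply: leq_ltn_trans lt_SS'.
apply: (lex_lt_mkseq (i := #|S|)) => // [|j lt_jS].
  rewrite countE // /size_count [X in _ < X](cardsD1 S) inE Sp eqxx ltnS.
  by apply: subset_leq_card; apply/subsetP=> S'; rewrite !inE andbA.
rewrite countE 1?ltnW //; apply: eq_card => S'; rewrite !inE.
by case: eqP => // ->; rewrite gtn_eqF ?andbF.
Qed.

(** Removing [S] does not increase the sum, and [U] gains at most [d] vertices. *)
Lemma folding_pair_size (R : realType) (c d : nat) (g : {set vertex H} -> R)
    p q :
  cd_hypergraph c d H -> well_formed c g p -> folding c g p q ->
  pair_size q <= pair_size p * 2 ^ d.
Proof.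
move=> cdH [_ wf _] [S [Sp Sc ->]]; rewrite /pair_size /= mulnDl -expnD.
apply: leq_add.
  apply: leq_trans (leq_pmulr _ _); last by rewrite expn_gt0.
  by rewrite [X in _ <= X](big_setD1 S) //= leq_addl.
rewrite leq_pexp2l //; apply: leq_trans (leq_card_setU _ _) _.
rewrite leq_add2l; apply: leq_trans (cdH S _ Sc); last by case: (wf S Sp).
by apply: subset_leq_card; rewrite subsetIl.
Qed.

Lemma transformation_pair_size (R : realType) (c d : nat) (ext : nat -> nat)
    (g : {set vertex H} -> R) p q :
  cd_hypergraph c d H -> well_formed c g p -> transformation c ext g p q ->
  pair_size q <= maxn (ext (pair_size p)) (pair_size p * 2 ^ d).
Proof.
move=> cdH wf [_ [fold|[_ le_q]]]; rewrite leq_max ?le_q //.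
by rewrite (folding_pair_size cdH wf fold) orbT.
Qed.

Lemma transformation_profile (R : realType) (c : nat) (ext : nat -> nat)
    (g : {set vertex H} -> R) p q :
  well_formed c g p -> transformation c ext g p q ->
  lex_lt (profile c q) (profile c p).
Proof.
move=> [_ wf _] [_ [[S [Sp _ ->]]|[[_ [S [T [Sp sTE ->]]]] _]]].
  apply: (profile_replace (N := set0) Sp) => [||S' /=]; last by rewrite inE.
    by case: (wf S Sp).
  by rewrite setU0.
apply: (profile_replace Sp) => //= [|S' /imsetP[e eT ->]].
  by case: (wf S Sp).
(* As [e] lies outside [S], the set [e |: S] is strictly larger than [S]. *)
by have := subsetP sTE e eT; rewrite cardsU1 inE => /andP[-> _].
Qed.

Lemma transformation_sequence_cons (R : realType) (c : nat) (k : R)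
    (ext : nat -> nat) (g : {set vertex H} -> R) p q s :
  transformation_sequence c k ext g [:: p, q & s] ->
  [/\ well_formed c g p, transformation c ext g p q
    & transformation_sequence c k ext g (q :: s)].
Proof.
move=> [wf step]; split; first by apply: wf; rewrite inE eqxx.
  by case: (step 0).
split=> [p' p's|i lt_i]; first by apply: wf; rewrite inE p's orbT.
exact: (step i.+1).
Qed.

End Profile.

Lemma profile_length_bound (R : realType) (c d : nat) (k : R)
    (ext : nat -> nat) (v : seq nat) (n : nat) :
  exists B : nat, forall (H : hypergraph) (g : {set vertex H} -> R)
      (p : edge_pair H) (s : seq (edge_pair H)),
    cd_hypergraph c d H -> transformation_sequence c k ext g (p :: s) ->
    profile c p = v -> pair_size p <= n -> size (p :: s) <= B.
Proof.
(* The bound [n] stays general, since sizes may grow while profiles decrease. *)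
elim/lex_lt_ind: v n => v IH n.
(* This bounds the size after one transformation; the maximum over all [j <= n] is taken because
   [ext] need not be monotone. *)
pose N := \max_(j < n.+1) maxn (ext j) (j * 2 ^ d).
have [|B hB] := @choice _ _ (fun w B => size w = size v -> lex_lt w v ->
    forall (H : hypergraph) (g : {set vertex H} -> R)
      (p : edge_pair H) (s : seq (edge_pair H)),
    cd_hypergraph c d H -> transformation_sequence c k ext g (p :: s) ->
    profile c p = w -> pair_size p <= N -> size (p :: s) <= B).
  move=> w; case: (eqVneq (size w) (size v)) => [sz_w|/eqP]; last by exists 0.
  case: (boolP (lex_lt w v)) => [lt_w|_]; last by exists 0.
  by have [B hB] := IH w sz_w lt_w N; exists B.
(* The successor counts [p] itself; the maximum covers every profile that the next pair can have. *)
exists (\max_(t : {ffun 'I_c.+1 -> 'I_N.+1}) B (seq_of_ffun t)).+1.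
move=> H g p [|q s] cdH // seq_ps prof_p le_pn.
have [wf step seq_qs] := transformation_sequence_cons seq_ps.
have le_qN : pair_size q <= N.
  apply: leq_trans (transformation_pair_size cdH wf step) _.
  have lt_pn : pair_size p < n.+1 by [].
  exact: (leq_bigmax (Ordinal lt_pn)).
have [t prof_q] := profile_bounded c le_qN.
rewrite /= ltnS; apply: leq_trans (leq_bigmax t).
rewrite -prof_q; apply: hB cdH seq_qs _ le_qN => //.
  by rewrite -prof_p !size_mkseq.
by rewrite -prof_p; apply: transformation_profile step.
Qed.

Theorem theorem3p13 (R : realType) (c d : nat) (k : R) (ext : nat -> nat)
  (hc : 1 <= c) (hext : extension_bound c d k ext) :
  exists sl : nat -> nat,
    {homo sl : m n / m <= n} /\
    forall (H : hypergraph) (g : {set vertex H} -> R)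
           (p : edge_pair H) (s : seq (edge_pair H)),
      cd_hypergraph c d H -> edge_weighting g -> (weight g <= k)%R ->
      transformation_sequence c k ext g (p :: s) ->
      size (p :: s) <= sl (pair_size p).
Proof.
have [B hB] := choice (fun vn : seq nat * nat =>
  profile_length_bound c d k ext vn.1 vn.2).
pose bound n : nat := \max_(t : {ffun 'I_c.+1 -> 'I_n.+1})
  B (seq_of_ffun t, n).
(* The running maximum makes the bound monotone. *)
exists (fun n => \max_(j < n.+1) bound j).
split=> [m n le_mn|H g p s cdH _ _ seq_ps].
  apply/bigmax_leqP => j _.
  exact: (leq_bigmax (widen_ord (_ : m.+1 <= n.+1) j)).
set n := pair_size p.
apply: leq_trans (leq_bigmax (ord_max : 'I_n.+1)).
have [t prof_p] := profile_bounded c (leqnn n).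
by apply: leq_trans (leq_bigmax t); apply: (hB (_, _)) cdH seq_ps prof_p _.
Qed.
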